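(* Let $\mathbf{F}$ be a finite field with $q$ elements. For $a,b,m,n\in\mathbb{N}$ let $N_{a,b}^{m,n}$ be the number of embeddings $V_{a,b}\to V_{m,n}$. There is a well-defined family of polynomials $Q_{a,b}\in\mathbb{Z}[1/q][t,u]$, $a,b\in\mathbb{N}$, determined by $Q_{0,0}=1$ and the recurrences $$Q_{a,b}(t,u)=q^{-1}(t-1)tu^2\,Q_{a-1,b}(q^{-2}t,u)\qquad(a\ge1),$$ $$Q_{a,b}(t,u)=q^{2a+b-1}(t-1)u\,Q_{a,b-1}(q^{-2}t,u)+q^{2a+b-1}(u-1)\,Q_{a,b-1}(t,q^{-1}u)\qquad(b\ge1),$$ and for all $a,b,m,n\in\mathbb{N}$ we have $$N_{a,b}^{m,n}=Q_{a,b}(q^{2m},q^n).$$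
   Context: $\mathbb{N}$ is the set of non-negative integers. $V_{m,n}$ is the $\mathbf{F}$-vector space of dimension $2m+n$ with the alternating bilinear form that is the orthogonal sum of a non-degenerate symplectic form on a $2m$-dimensional space and the zero form on an $n$-dimensional space. An embedding is an injective $\mathbf{F}$-linear map preserving the forms. ''Well-defined'' means that the initial condition together with both recurrences (each imposed whenever its condition holds) are consistent and determine all the $Q_{a,b}$. *)

(* Defs.v *)
From HB Require Import structures.
From mathcomp Require Import all_boot all_order all_algebra.
From mathcomp Require Import mpoly.

Set Implicit Arguments.
Unset Strict Implicit.
Unset Printing Implicit Defensive.

Import GRing.Theory.

Local Open Scope ring_scope.

(* V_{m,n} is modelled as the row vectors of length (m + m) + n: the hyperbolic
   form on the first 2m coordinates, the zero form on the last n. *)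
Definition Vspace (F : finFieldType) (m n : nat) := 'rV[F]_(m + m + n).

Definition gram (F : finFieldType) (m n : nat) : 'M[F]_(m + m + n) :=
  block_mx (block_mx 0 1%:M (- 1%:M) 0) 0 0 0.

Definition form (F : finFieldType) (m n : nat) (x y : Vspace F m n) : F :=
  (x *m gram F m n *m y^T) 0 0.

Definition is_embedding (F : finFieldType) (a b m n : nat)
    (f : {ffun Vspace F a b -> Vspace F m n}) : bool :=
  [&& [forall c : F, forall x, forall y, f (c *: x + y) == c *: f x + f y],
      injectiveb f
    & [forall x, forall y, form (f x) (f y) == form x y]].

Definition num_embeddings (F : finFieldType) (a b m n : nat) : nat :=
  #|[set f : {ffun Vspace F a b -> Vspace F m n} | is_embedding f]|.

Lemma form_alternating (F : finFieldType) (m n : nat) (x : Vspace F m n) :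
  form x x = 0.
Proof.
rewrite /form -[x]hsubmxK -[lsubmx x]hsubmxK.
set u := lsubmx (lsubmx x); set v := rsubmx (lsubmx x); set w := rsubmx x.
rewrite /gram !mul_row_block !tr_row_mx !mul_row_col !mulmx0 !add0r !addr0.
rewrite mul_row_col mul0mx addr0 mulmxN !mulmx1 mulNmx !mxE addrC -sumrB.
by rewrite big1 // => i _; rewrite !mxE mulrC subrr.
Qed.

Lemma form_radical (F : finFieldType) (m n : nat) (x : Vspace F m n) :
  (forall y, form x y = 0) <-> lsubmx x = 0.
Proof.
split=> [x0 | x0 y]; last first.
  rewrite /form -[x]hsubmxK x0 /gram mul_row_block !mul0mx !mulmx0 !addr0.
  by rewrite row_mx0 mul0mx mxE.
have gx0 : x *m gram F m n = 0.
  apply/rowP=> j; have := x0 (delta_mx 0 j).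
  by rewrite /form trmx_delta -colE !mxE.
move: gx0; rewrite -{1}[x]hsubmxK -{1}[lsubmx x]hsubmxK /gram !mul_row_block.
rewrite !mulmx0 !add0r !addr0 mulmx1 mulmxN mulmx1 => g0.
have [/eq_row_mx[v0 u0] _] : row_mx (- rsubmx (lsubmx x)) (lsubmx (lsubmx x))
  = row_mx 0 0 :> 'rV_(m + m) /\ 0 = 0 :> 'rV[F]_n.
  by apply: eq_row_mx; rewrite g0 !row_mx0.
by rewrite -[lsubmx x]hsubmxK u0 -[rsubmx _]opprK v0 oppr0 row_mx0.
Qed.

Definition tvar : {mpoly rat[2]} := 'X_ord0.
Definition uvar : {mpoly rat[2]} := 'X_ord_max.

Definition subst2 (P x y : {mpoly rat[2]}) : {mpoly rat[2]} :=
  P \mPo [tuple x; y].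

Definition eval2 (P : {mpoly rat[2]}) (x y : rat) : rat :=
  P.@[tnth [tuple x; y]].

Definition in_Zinv (q : nat) (c : rat) : Prop :=
  exists (z : int) (k : nat), c = z%:~R / q%:R ^+ k.

Definition over_Zinv (q : nat) (P : {mpoly rat[2]}) : Prop :=
  forall mon : 'X_{1..2}, in_Zinv q P@_mon.

Definition is_Qfamily (q : nat) (Q : nat -> nat -> {mpoly rat[2]}) : Prop :=
  [/\ forall a b : nat, over_Zinv q (Q a b),
      Q 0 0 = 1,
      forall a b : nat, (1 <= a)%N ->
        Q a b = q%:R^-1 *: ((tvar - 1) * tvar * uvar ^+ 2
                            * subst2 (Q (a - 1)%N b) (q%:R ^- 2 *: tvar) uvar)
    & forall a b : nat, (1 <= b)%N ->
        Q a b = q%:R ^+ (2 * a + b - 1) *: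
                  ((tvar - 1) * uvar * subst2 (Q a (b - 1)%N) (q%:R ^- 2 *: tvar) uvar)
              + q%:R ^+ (2 * a + b - 1) *:
                  ((uvar - 1) * subst2 (Q a (b - 1)%N) tvar (q%:R^-1 *: uvar))].

(* Main.v *)
Require Import Defs.
From HB Require Import structures.
From mathcomp Require Import all_boot all_order all_algebra.
From mathcomp Require Import mxabelem.
From mathcomp Require Import mpoly ring.

(* Write t = q^(2m), u = q^n, and let the source be V_{a,b}.  The second
   recurrence counts embeddings by the image v of a vector spanning part of the
   radical of V_{a,b}: v is one of (t - 1) u vectors outside the radical of V_{m,n}, and
   then v^perp / v is V_{m-1,n}, or one of u - 1 nonzero vectors of the radical,
   and then V_{m,n} / v is V_{m,n-1}; an embedding of the quotient lifts in
   q^(2a+b-1) ways.  The first recurrence counts by the image of a hyperbolic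
   pair, of which there are (t - 1) u * (q^-1 t u), and whose orthogonal
   complement is V_{m-1,n}.  Since both steps commute up to a shift of the
   exponent, Q_{a,b} may be built by first raising b and then raising a, so that
   only the case a = 0 of the second count is needed.  Counting for arbitrary
   alternating Gram matrices of the right rank, rather than for the standard
   ones, avoids any classification of alternating forms. *)

Set Implicit Arguments.
Unset Strict Implicit.
Unset Printing Implicit Defensive.

Import GRing.Theory.

Local Open Scope ring_scope.

(** * Substitution and evaluation for polynomials in t and u *)

Lemma tnth_pair (T : Type) (x y : T) (i : 'I_2) :
  tnth [tuple x; y] i = if i == ord0 then x else y.
Proof. by case: i => [[|[|i]]] //= lt_i2; rewrite (tnth_nth x). Qed.

Lemma comp_mpolyA (R : comNzRingType) (n k l : nat) (p : {mpoly R[n]})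
    (s : n.-tuple {mpoly R[k]}) (r : k.-tuple {mpoly R[l]}) :
  (p \mPo s) \mPo r = p \mPo [tuple tnth s i \mPo r | i < n].
Proof.
rewrite (comp_mpolyEX p) [RHS]comp_mpolyE raddf_sum /=.
apply: eq_bigr => m _; rewrite comp_mpolyZ comp_mpolyX rmorph_prod /=.
by congr (_ *: _); apply: eq_bigr => i _; rewrite rmorphXn /= tnth_mktuple.
Qed.

Lemma subst2M (P R x y : {mpoly rat[2]}) :
  subst2 (P * R) x y = subst2 P x y * subst2 R x y.
Proof. exact: rmorphM. Qed.

Lemma subst2X (P x y : {mpoly rat[2]}) (k : nat) :
  subst2 (P ^+ k) x y = subst2 P x y ^+ k.
Proof. exact: rmorphXn. Qed.

Lemma subst2D (P R x y : {mpoly rat[2]}) :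
  subst2 (P + R) x y = subst2 P x y + subst2 R x y.
Proof. exact: comp_mpolyD. Qed.

Lemma subst2Z (c : rat) (P x y : {mpoly rat[2]}) :
  subst2 (c *: P) x y = c *: subst2 P x y.
Proof. exact: comp_mpolyZ. Qed.

Lemma subst2N1 (x y : {mpoly rat[2]}) : subst2 (-1) x y = -1.
Proof. by rewrite /subst2 comp_mpolyN comp_mpoly1. Qed.

Lemma subst2_subst2 (P x y x' y' : {mpoly rat[2]}) :
  subst2 (subst2 P x y) x' y' = subst2 P (subst2 x x' y') (subst2 y x' y').
Proof.
rewrite /subst2 comp_mpolyA //; congr (_ \mPo _); apply: eq_from_tnth => i.
by rewrite tnth_mktuple !tnth_pair; case: ifP.
Qed.

Lemma subst2_tvar (x y : {mpoly rat[2]}) : subst2 tvar x y = x.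
Proof. by rewrite /subst2 comp_mpolyXU. Qed.

Lemma subst2_uvar (x y : {mpoly rat[2]}) : subst2 uvar x y = y.
Proof. by rewrite /subst2 comp_mpolyXU. Qed.

Lemma eval2_subst2 (P x y : {mpoly rat[2]}) (t u : rat) :
  eval2 (subst2 P x y) t u = eval2 P (eval2 x t u) (eval2 y t u).
Proof.
rewrite /eval2 /subst2 comp_mpoly_meval; apply: meval_eq => i.
by rewrite !tnth_pair; case: ifP.
Qed.

Lemma eval2_tvar (t u : rat) : eval2 tvar t u = t.
Proof. by rewrite /eval2 mevalXU. Qed.

Lemma eval2_uvar (t u : rat) : eval2 uvar t u = u.
Proof. by rewrite /eval2 mevalXU. Qed.

(** * The recurrence operators and their commutation *)

Definition step_a (q : nat) (P : {mpoly rat[2]}) : {mpoly rat[2]} :=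
  q%:R^-1 *: ((tvar - 1) * tvar * uvar ^+ 2 * subst2 P (q%:R ^- 2 *: tvar) uvar).

(** The exponent [c] stands for 2a + b - 1; it is kept free because commuting with [step_a] shifts
    it. *)
Definition step_b (q c : nat) (P : {mpoly rat[2]}) : {mpoly rat[2]} :=
  q%:R ^+ c *: ((tvar - 1) * uvar * subst2 P (q%:R ^- 2 *: tvar) uvar)
  + q%:R ^+ c *: ((uvar - 1) * subst2 P tvar (q%:R^-1 *: uvar)).

(** The identity behind the commutation, with K = q^(c+2), k = q^-1, P1 = P(q^-4 t, u) and P2 =
    P(q^-2 t, q^-1 u). Scalars are rewritten as products with their images in the algebra, so that
    [ring] applies. *)
Lemma step_ab_algebra (R : comNzRingType) (A : comAlgType R) (k K : R)
    (t u P1 P2 : A) :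
  K *: ((t - 1) * u *
        (k *: ((k ^+ 2 *: t - 1) * (k ^+ 2 *: t) * u ^+ 2 * P1)))
  + K *: ((u - 1) * (k *: ((t - 1) * t * (k *: u) ^+ 2 * P2)))
  = k *: ((t - 1) * t * u ^+ 2 *
          ((K * k ^+ 2) *: ((k ^+ 2 *: t - 1) * u * P1)
           + (K * k ^+ 2) *: ((u - 1) * P2))).
Proof.
have [f fM scaleE] : exists2 f : R -> A, {morph f : x y / x * y}
    & forall c x, c *: x = f c * x.
  by exists (in_alg A) => [x y | c x]; rewrite ?rmorphM //= mulr_algl.
by rewrite !scaleE [k ^+ 2]expr2 !fM; ring.
Qed.

(** The prefactor t u^2 of [step_a] gains q^-2 under t -> q^-2 t and also under u -> q^-1 u. This
    offsets the shift of the exponent by two, which is the change of 2a + b - 1 when a grows by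
    one. *)
Lemma step_ab (q c : nat) (P : {mpoly rat[2]}) : (0 < q)%N ->
  step_b q c.+2 (step_a q P) = step_a q (step_b q c P).
Proof.
move=> q_gt0; have q0 : q%:R != 0 :> rat by rewrite Num.Theory.pnatr_eq0 -lt0n.
have qc : q%:R ^+ c = q%:R ^+ c.+2 * q%:R ^- 2 :> rat.
  by rewrite -addn2 exprD mulfK // expf_neq0.
rewrite /step_a /step_b qc -exprVn.
move: (q%:R ^+ c.+2) (q%:R^-1) => K k.
move: tvar uvar subst2_tvar subst2_uvar => t u subst2_t subst2_u.
rewrite !(subst2Z, subst2D, subst2X, subst2M, subst2N1, subst2_subst2,
          subst2_t, subst2_u).
set P1 := subst2 _ _ _; set P2 := subst2 _ _ _.
exact: (@step_ab_algebra rat {mpoly rat[2]} k K t u P1 P2).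
Qed.

(** The column a = 0, where 2a + b - 1 is the predecessor of b. *)
Fixpoint Qpoly0 (q b : nat) : {mpoly rat[2]} :=
  if b is b'.+1 then step_b q b' (Qpoly0 q b') else 1.

Fixpoint Qpoly (q a b : nat) : {mpoly rat[2]} :=
  if a is a'.+1 then step_a q (Qpoly q a' b) else Qpoly0 q b.

(** This is the consistency of the two recurrences: the new [step_b] is moved inwards past every
    [step_a] to the column a = 0, where it holds by definition. *)
Lemma QpolyS (q a b : nat) : (0 < q)%N ->
  Qpoly q a b.+1 = step_b q (2 * a + b) (Qpoly q a b).
Proof.
move=> q_gt0; elim: a => [|a IHa]; first exact: erefl.
have -> : (2 * a.+1 + b = (2 * a + b).+2)%N by rewrite mulnS.
exact: etrans (congr1 (step_a q) IHa) (esym (step_ab _ _ q_gt0)).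
Qed.

(** * Coefficients in Z[1/q] *)

Lemma in_Zinv_int (q : nat) (z : int) : in_Zinv q z%:~R.
Proof. by exists z, 0%N; rewrite divr1. Qed.

Lemma in_ZinvV (q k : nat) : in_Zinv q (q%:R ^- k).
Proof. by exists 1, k; rewrite div1r. Qed.

Lemma in_ZinvM (q : nat) (x y : rat) :
  in_Zinv q x -> in_Zinv q y -> in_Zinv q (x * y).
Proof.
move=> [z [k ->]] [w [l ->]]; exists (z * w), (k + l)%N.
by rewrite mulf_div -intrM exprD.
Qed.

Lemma in_ZinvD (q : nat) (x y : rat) : (0 < q)%N ->
  in_Zinv q x -> in_Zinv q y -> in_Zinv q (x + y).
Proof.
move=> q_gt0; have q0 : q%:R != 0 :> rat by rewrite Num.Theory.pnatr_eq0 -lt0n.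
move=> [z [k ->]] [w [l ->]].
exists (z * q%:Z ^+ l + w * q%:Z ^+ k), (k + l)%N.
by rewrite addf_div ?expf_neq0 // exprD intrD !intrM !rmorphXn.
Qed.

Lemma in_Zinv_sum (q : nat) (I : Type) (r : seq I) (A : pred I) (f : I -> rat) :
  (0 < q)%N -> (forall i, A i -> in_Zinv q (f i)) ->
  in_Zinv q (\sum_(i <- r | A i) f i).
Proof.
move=> q_gt0 fZ; elim/big_ind: _ => //; first exact: (in_Zinv_int q 0).
by move=> x y; apply: in_ZinvD.
Qed.

Lemma over_ZinvD (q : nat) (P R : {mpoly rat[2]}) : (0 < q)%N ->
  over_Zinv q P -> over_Zinv q R -> over_Zinv q (P + R).
Proof. by move=> ? PZ RZ m; rewrite mcoeffD; apply: in_ZinvD. Qed.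

Lemma over_ZinvM (q : nat) (P R : {mpoly rat[2]}) : (0 < q)%N ->
  over_Zinv q P -> over_Zinv q R -> over_Zinv q (P * R).
Proof.
move=> q_gt0 PZ RZ m; rewrite mcoeffM; apply: in_Zinv_sum => // i _.
exact: in_ZinvM.
Qed.

Lemma over_ZinvZ (q : nat) (c : rat) (P : {mpoly rat[2]}) :
  in_Zinv q c -> over_Zinv q P -> over_Zinv q (c *: P).
Proof. by move=> cZ PZ m; rewrite mcoeffZ; apply: in_ZinvM. Qed.

Lemma over_ZinvX (q : nat) (m : 'X_{1..2}) : over_Zinv q 'X_[m].
Proof. by move=> k; rewrite mcoeffX; apply: (in_Zinv_int q (m == k)). Qed.

Lemma over_Zinv1 (q : nat) : over_Zinv q 1.
Proof. by rewrite -mpolyX0; apply: over_ZinvX. Qed.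

Lemma over_Zinv_exp (q k : nat) (P : {mpoly rat[2]}) : (0 < q)%N ->
  over_Zinv q P -> over_Zinv q (P ^+ k).
Proof.
move=> q_gt0 PZ; elim: k => [|k IHk]; first exact: over_Zinv1.
by rewrite exprS; apply: over_ZinvM.
Qed.

Lemma over_Zinv_subst2 (q : nat) (P x y : {mpoly rat[2]}) : (0 < q)%N ->
  over_Zinv q P -> over_Zinv q x -> over_Zinv q y -> over_Zinv q (subst2 P x y).
Proof.
move=> q_gt0 PZ xZ yZ; rewrite /subst2 comp_mpolyEX.
elim/big_rec: _ => [|m R _ RZ]; first by move=> m; rewrite mcoeff0; apply: (in_Zinv_int q 0).
apply: over_ZinvD => //; apply: over_ZinvZ => //; rewrite comp_mpolyX.
elim/big_rec: _ => [|i S _ SZ]; first exact: over_Zinv1.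
by apply: over_ZinvM => //; apply: over_Zinv_exp => //; rewrite tnth_pair; case: ifP.
Qed.

Lemma over_ZinvX1 (q : nat) (m : 'X_{1..2}) : (0 < q)%N ->
  over_Zinv q ('X_[m] - 1).
Proof.
move=> q_gt0; apply: over_ZinvD => //; first exact: over_ZinvX.
by rewrite -scaleN1r; apply: over_ZinvZ (@over_Zinv1 q); apply: (in_Zinv_int q (-1)).
Qed.

Lemma over_Zinv_step_a (q : nat) (P : {mpoly rat[2]}) : (0 < q)%N ->
  over_Zinv q P -> over_Zinv q (step_a q P).
Proof.
move=> q_gt0 PZ.
(* The search descends through products, powers, scalings and the substitution to powers of q^-1,
   monomials and [P]. *)
by do ?[exact: (in_ZinvV q 1) | exact: in_ZinvV | exact: over_ZinvX | exact: over_ZinvX1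
 | apply: over_Zinv_subst2 => // | apply: over_Zinv_exp => //
 | apply: over_ZinvZ | apply: over_ZinvM => //].
Qed.

Lemma over_Zinv_step_b (q c : nat) (P : {mpoly rat[2]}) : (0 < q)%N ->
  over_Zinv q P -> over_Zinv q (step_b q c P).
Proof.
move=> q_gt0 PZ; have qZ : in_Zinv q (q%:R ^+ c).
  by rewrite -natrX; apply: (in_Zinv_int q (q ^ c)%N).
by do ?[exact: qZ | exact: (in_ZinvV q 1) | exact: in_ZinvV | exact: over_ZinvX | exact: over_ZinvX1
 | apply: over_Zinv_subst2 => // | apply: over_ZinvD => //
 | apply: over_ZinvZ | apply: over_ZinvM => //].
Qed.

Lemma over_Zinv_Qpoly (q a b : nat) : (0 < q)%N -> over_Zinv q (Qpoly q a b).
Proof.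
move=> q_gt0; elim: a => [|a IHa] /=; last exact: over_Zinv_step_a.
elim: b => [|b IHb] /=; first exact: over_Zinv1.
exact: over_Zinv_step_b.
Qed.

(** * Existence and uniqueness of the family *)

Lemma Qpoly_is_Qfamily (q : nat) : (0 < q)%N -> is_Qfamily q (Qpoly q).
Proof.
move=> q_gt0; split=> [a b | | a b a_gt0 | a b b_gt0].
- exact: over_Zinv_Qpoly.
- exact: erefl.
- case: a a_gt0 => // a _; have -> : (a.+1 - 1)%N = a by rewrite subn1.
  exact: erefl.
- case: b b_gt0 => // b _; rewrite [(b.+1 - 1)%N]subn1.
  have -> : (2 * a + b.+1 - 1 = 2 * a + b)%N by rewrite addnS subn1.
  exact: QpolyS.
Qed.

(** The second recurrence fixes the column a = 0 by induction on b; the first then fixes each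
    further column from the previous one. *)
Lemma Qfamily_unique (q : nat) (Q Q' : nat -> nat -> {mpoly rat[2]}) :
  is_Qfamily q Q -> is_Qfamily q Q' -> forall a b, Q' a b = Q a b.
Proof.
move=> [_ Q00 Qa Qb] [_ Q00' Qa' Qb'] a b; elim: a b => [|a IHa] b.
  elim: b => [|b IHb]; first by rewrite Q00.
  have {}IHb : Q' 0%N (b.+1 - 1)%N = Q 0%N (b.+1 - 1)%N by rewrite subn1.
  by rewrite (Qb _ _ (ltn0Sn b)) (Qb' _ _ (ltn0Sn b)) IHb; apply: erefl.
have {}IHa : Q' (a.+1 - 1)%N b = Q (a.+1 - 1)%N b by rewrite subn1.
by rewrite (Qa _ _ (ltn0Sn a)) (Qa' _ _ (ltn0Sn a)) IHa; apply: erefl.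
Qed.

(** * Values of the recurrence operators *)

Lemma eval2M (P R : {mpoly rat[2]}) (t u : rat) :
  eval2 (P * R) t u = eval2 P t u * eval2 R t u.
Proof. exact: mevalM. Qed.

Lemma eval2D (P R : {mpoly rat[2]}) (t u : rat) :
  eval2 (P + R) t u = eval2 P t u + eval2 R t u.
Proof. exact: mevalD. Qed.

Lemma eval2Z (c : rat) (P : {mpoly rat[2]}) (t u : rat) :
  eval2 (c *: P) t u = c * eval2 P t u.
Proof. exact: mevalZ. Qed.

Lemma eval2X (P : {mpoly rat[2]}) (k : nat) (t u : rat) :
  eval2 (P ^+ k) t u = eval2 P t u ^+ k.
Proof. exact: rmorphXn. Qed.

Lemma eval2_1 (t u : rat) : eval2 1 t u = 1.
Proof. exact: meval1. Qed.

Lemma eval2N1 (t u : rat) : eval2 (- 1) t u = - 1.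
Proof. by rewrite /eval2 mevalN meval1. Qed.

Lemma eval2_step_a (q : nat) (P : {mpoly rat[2]}) (t u : rat) :
  eval2 (step_a q P) t u
  = q%:R^-1 * ((t - 1) * t * u ^+ 2 * eval2 P (q%:R ^- 2 * t) u).
Proof.
rewrite /step_a; move: tvar uvar eval2_tvar eval2_uvar => tv uv tE uE.
by rewrite !(eval2D, eval2Z, eval2X, eval2M, eval2_subst2, eval2N1, tE, uE).
Qed.

Lemma eval2_step_b (q c : nat) (P : {mpoly rat[2]}) (t u : rat) :
  eval2 (step_b q c P) t u
  = q%:R ^+ c * ((t - 1) * u * eval2 P (q%:R ^- 2 * t) u)
    + q%:R ^+ c * ((u - 1) * eval2 P t (q%:R^-1 * u)).
Proof.
rewrite /step_b; move: tvar uvar eval2_tvar eval2_uvar => tv uv tE uE.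
by rewrite !(eval2D, eval2Z, eval2M, eval2_subst2, eval2N1, tE, uE).
Qed.

(** * Isometries and extensions for alternating Gram matrices *)

Definition alternating (F : finFieldType) (d : nat) (G : 'M[F]_d) : Prop :=
  forall v : 'rV_d, v *m G *m v^T = 0.

(** The rows of [M] are the images of the basis vectors, so [row_free] is injectivity and the
    equation is preservation of the form. *)
Definition isometries (F : finFieldType) (k d : nat) (B : 'M[F]_k) (G : 'M[F]_d) :
    {set 'M[F]_(k, d)} :=
  [set M | row_free M && (M *m G *m M^T == B)].

(** With the images [E] of the first basis vectors fixed, these are the possible images of the
    remaining ones when the source is an orthogonal sum. *)
Definition extensions (F : finFieldType) (p k d : nat) (E : 'M[F]_(p, d))
    (B : 'M[F]_k) (G : 'M[F]_d) : {set 'M[F]_(k, d)} :=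
  [set M | [&& row_free (col_mx E M), M *m G *m M^T == B & E *m G *m M^T == 0]].

Definition hyperbolic (F : finFieldType) : 'M[F]_(1 + 1) :=
  block_mx 0 1%:M (- 1%:M) 0.

Lemma alternating_congr (F : finFieldType) (k d : nat) (P : 'M[F]_(k, d)) (G : 'M[F]_d) :
  alternating G -> alternating (P *m G *m P^T).
Proof. by move=> altG v; have := altG (v *m P); rewrite trmx_mul !mulmxA. Qed.

Lemma bilin_delta (F : fieldType) (k d : nat) (G : 'M[F]_(k, d)) (i : 'I_k) (j : 'I_d) :
  ((delta_mx 0 i : 'rV_k) *m G *m (delta_mx 0 j : 'rV_d)^T) 0 0 = G i j.
Proof. by rewrite trmx_delta -rowE -colE !mxE. Qed.

Lemma alternating_tr (F : finFieldType) (d : nat) (G : 'M[F]_d) :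
  alternating G -> G^T = - G.
Proof.
move=> altG; apply/matrixP => i j; rewrite !mxE; apply/eqP.
rewrite -addr_eq0 -(bilin_delta G j i) -(bilin_delta G i j).
set x := delta_mx 0 j; set y := delta_mx 0 i.
have /(congr1 (fun A : 'M_1 => A 0 0)) := altG (x + y).
rewrite linearD /= !mulmxDl !mulmxDr !altG addr0 add0r !mxE => E.
by rewrite E.
Qed.

(** One off-diagonal block of a Gram matrix determines the other, so orthogonality has to be checked
    on one side only. *)
Lemma alternating_swap (F : finFieldType) (p k d : nat) (G : 'M[F]_d)
    (X : 'M[F]_(p, d)) (Y : 'M[F]_(k, d)) :
  alternating G -> Y *m G *m X^T = - (X *m G *m Y^T)^T.
Proof.
move=> altG.
by rewrite !trmx_mul trmxK (alternating_tr altG) mulNmx mulmxN opprK mulmxA.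
Qed.

(** Since [E] has rank p, it is an invertible multiple of the first p rows of the invertible matrix
    [row_ebase E]; the other rows complete it. *)
Lemma exists_complement (F : fieldType) (p d : nat) (E : 'M[F]_(p, p + d)) :
  row_free E -> exists C : 'M_(d, p + d), col_mx E C \in unitmx.
Proof.
move=> /eqP rE; exists (dsubmx (row_ebase E)).
have -> : col_mx E (dsubmx (row_ebase E))
  = block_mx (col_ebase E) 0 0 1%:M *m row_ebase E.
  rewrite -{1}(mulmx_ebase E) rE pid_mx_row -{1 3}[row_ebase E]vsubmxK.
  by rewrite mul_block_col -mulmxA mul_row_col !mul1mx !mul0mx !addr0 add0r.
rewrite unitmx_mul row_ebase_unit andbT unitmxE det_lblock det1 mulr1.
by rewrite -unitmxE col_ebase_unit.
Qed.

(** Left multiplication by [P], a change of basis of the source, is a bijection between the two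
    sets. *)
Lemma card_isometries_congr (F : finFieldType) (k d : nat)
    (P B : 'M[F]_k) (G : 'M[F]_d) : P \in unitmx ->
  #|isometries (P *m B *m P^T) G| = #|isometries B G|.
Proof.
move=> uP; have uPT : P^T \in unitmx by rewrite unitmx_tr.
rewrite -[LHS](on_card_preimset (f := mulmx P)); last first.
  by exists (mulmx (invmx P)) => M _ /=; rewrite ?mulKmx ?mulKVmx.
apply: eq_card => M; rewrite !inE /= trmx_mul.
have -> : row_free (P *m M) = row_free M.
  by rewrite /row_free eqmxMfull // row_full_unit.
congr (_ && _); rewrite !mulmxA; apply/eqP/eqP => [|<-]; last by rewrite !mulmxA.
by move/(can_inj (mulmxK uPT)); rewrite -!mulmxA => /(can_inj (mulKmx uP)).
Qed.

Lemma card_isometries_block (F : finFieldType) (p k d : nat) (A : 'M[F]_p)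
    (B : 'M[F]_k) (G : 'M[F]_d) : alternating G ->
  #|isometries (block_mx A 0 0 B) G|
  = (\sum_(E : 'M_(p, d) | E *m G *m E^T == A) #|extensions E B G|)%N.
Proof.
move=> altG; rewrite -sum1_card.
rewrite (reindex (fun x : 'M[F]_(p, d) * 'M[F]_(k, d) => col_mx x.1 x.2)) /=; last first.
  exists (fun M => (usubmx M, dsubmx M)) => [[E M] _|M _] /=.
    by rewrite col_mxKu col_mxKd.
  exact: vsubmxK.
under [RHS]eq_bigr do rewrite -sum1_card.
rewrite pair_big_dep /=; apply: eq_bigl => [[E M]]; rewrite !inE /=.
rewrite tr_col_mx mul_col_mx mul_col_row (alternating_swap E M altG).
apply/andP/and4P => [[-> /eqP/eq_block_mx[-> -> _ ->]] | [/eqP-> -> /eqP-> /eqP->]] //.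
by rewrite trmx0 oppr0.
Qed.

(** * Counting extensions in adapted coordinates *)

(** A change of basis of the target; it serves to bring [E] into coordinate position. *)
Lemma card_extensions_mulr (F : finFieldType) (p k d : nat) (E : 'M[F]_(p, d))
    (B : 'M[F]_k) (P G : 'M[F]_d) : P \in unitmx ->
  #|extensions (E *m P) B G| = #|extensions E B (P *m G *m P^T)|.
Proof.
move=> uP; rewrite -[LHS](on_card_preimset (f := mulmxr P)); last first.
  by exists (mulmxr (invmx P)) => M _ /=; rewrite ?mulmxK ?mulmxKV.
apply: eq_card => M; rewrite !inE /= trmx_mul !mulmxA -mul_col_mx.
by rewrite /row_free mxrankMfree // row_free_unit.
Qed.

Lemma row_free_unitriangular (F : fieldType) (p k d : nat) (X : 'M[F]_(k, p))
    (W : 'M[F]_(k, d)) :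
  row_free (col_mx (row_mx 1%:M 0) (row_mx X W)) = row_free W.
Proof.
rewrite -/(block_mx _ _ _ _).
have -> : block_mx 1%:M 0 X W = block_mx 1%:M 0 X 1%:M *m block_mx 1%:M 0 0 W.
  by rewrite mulmx_block !mul1mx !mulmx1 !mul0mx !mulmx0 !addr0 !add0r.
have uX : block_mx 1%:M 0 X (1%:M : 'M_k) \in unitmx.
  by rewrite unitmxE det_lblock !det1 mulr1 unitr1.
rewrite /row_free eqmxMfull ?row_full_unit // rank_diag_block_mx mxrank1.
by rewrite eqn_add2l.
Qed.

(** Orthogonality to the first block reads A X^T = 0 for the first coordinates X of an extension,
    hence X = 0. *)
Lemma card_extensions_nondegenerate (F : finFieldType) (p k d : nat)
    (A : 'M[F]_p) (B : 'M[F]_k) (G : 'M[F]_d) : A \in unitmx ->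
  #|extensions (row_mx 1%:M 0) B (block_mx A 0 0 G)| = #|isometries B G|.
Proof.
move=> uA; rewrite -[RHS](card_imset _ (f := row_mx (0 : 'M_(k, p)))); last first.
  by move=> W W' /eq_row_mx[].
apply: eq_card => M; rewrite -[M]hsubmxK; move: (lsubmx M) (rsubmx M) => X W.
rewrite inE row_free_unitriangular tr_row_mx !mul_row_block !mul_row_col.
rewrite !(mul0mx, mulmx0, addr0, add0r, mul1mx).
apply/and3P/imsetP => [[fW /eqP gW /eqP AX]|[W' fW /eq_row_mx[-> ->]]].
  have X0 : X = 0 by apply: trmx_inj; rewrite -[LHS](mulKmx uA) AX mulmx0 trmx0.
  by exists W; rewrite ?X0 // inE fW -gW X0 !mul0mx add0r eqxx.
move: fW; rewrite inE => /andP[-> /eqP->].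
by rewrite trmx0 !mulmx0 add0r !eqxx.
Qed.

(** The coordinates along the radical block affect neither the form nor freeness modulo that block,
    so they are arbitrary. *)
Lemma card_extensions_radical (F : finFieldType) (p k d : nat)
    (B : 'M[F]_k) (G : 'M[F]_d) :
  #|extensions (row_mx (1%:M : 'M_p) 0) B (block_mx 0 0 0 G)|
  = (#|F| ^ (k * p) * #|isometries B G|)%N.
Proof.
rewrite -card_mx -cardsT -cardsX.
rewrite -[RHS](card_imset _ (f := fun x : 'M[F]_(k, p) * 'M[F]_(k, d) => row_mx x.1 x.2));
  last by move=> [X W] [X' W'] /= /eq_row_mx[-> ->].
apply: eq_card => M; rewrite -[M]hsubmxK; move: (lsubmx M) (rsubmx M) => X W.
rewrite inE row_free_unitriangular tr_row_mx !mul_row_block !mul_row_col.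
rewrite !(mul0mx, mulmx0, addr0, add0r, mul1mx) eqxx andbT.
apply/idP/imsetP => [gW|[[X' W'] gW /eq_row_mx[_ ->]]].
  by exists (X, W) => //; rewrite !inE.
by move: gW; rewrite !inE.
Qed.

(** For a hyperbolic pair e, f with e fixed, orthogonality to e kills the f-coordinate. The
    e-coordinate is then arbitrary, since e is isotropic and orthogonal to the rest. *)
Lemma card_extensions_hyperbolic (F : finFieldType) (k d : nat)
    (B : 'M[F]_k) (G : 'M[F]_d) :
  #|extensions (row_mx (row_mx (1%:M : 'M_1) (0 : 'M_1)) 0) B
      (block_mx (hyperbolic F) 0 0 G)|
  = (#|F| ^ k * #|isometries B G|)%N.
Proof.
rewrite -[X in (_ ^ X)%N]muln1 -card_mx -cardsT -cardsX.
rewrite -[RHS](card_imset _ (f := fun x : 'M[F]_(k, 1) * 'M[F]_(k, d) =>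
   row_mx (row_mx x.1 (0 : 'M_(k, 1))) x.2));
  last by move=> [X W] [X' W'] /= /eq_row_mx[/eq_row_mx[-> _] ->].
apply: eq_card => M; rewrite -[M]hsubmxK -[lsubmx M]hsubmxK.
move: (lsubmx (lsubmx M)) (rsubmx (lsubmx M)) (rsubmx M) => X Y W.
rewrite inE /hyperbolic !tr_row_mx !mul_row_block !mul_row_col.
rewrite !(mul0mx, mulmx0, addr0, add0r, mul_row_block, mul_row_col, mulmx1, mul1mx).
have freeE (X0 : 'cV_k) (W0 : 'M_(k, d)) :
    row_free (col_mx (row_mx (row_mx (1%:M : 'M_1) (0 : 'M_1)) 0)
      (row_mx (row_mx X0 0) W0)) = row_free W0.
  apply/idP/idP => fW; apply: inj_row_free => u uM.
    (* A relation u among the rows of [W0] lifts to a relation with coefficient -u X0 on e. *)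
    have /eqP : row_mx (- (u *m X0)) u *m
      col_mx (row_mx (row_mx (1%:M : 'M_1) (0 : 'M_1)) 0) (row_mx (row_mx X0 0) W0) = 0.
      rewrite mul_row_col !mul_mx_row !mulmx0 mulmx1 uM !add_row_mx.
      by rewrite addNr !addr0 !row_mx0.
    by rewrite mulmx_free_eq0 // => /eqP; rewrite -row_mx0 => /eq_row_mx[_ ->].
  move: uM; rewrite -[u]hsubmxK; move: (lsubmx u) (rsubmx u) => a w.
  rewrite mul_row_col !mul_mx_row !mulmx0 mulmx1 !add_row_mx !addr0 !add0r => uM.
  have /eq_row_mx[/eq_row_mx[aX _] wW] : row_mx (row_mx (a + w *m X0) (0 : 'M_1)) (w *m W0)
    = row_mx (row_mx 0 0) 0 by rewrite uM !row_mx0.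
  have w0 : w = 0 by apply/eqP; rewrite -(mulmx_free_eq0 _ fW) wW.
  by move: aX; rewrite w0 mul0mx addr0 => ->; rewrite row_mx0.
apply/and3P/imsetP => [[fW /eqP gW /eqP Y0T]|].
  have Y0 : Y = 0 by apply: trmx_inj; rewrite Y0T trmx0.
  rewrite Y0 freeE in fW; exists (X, W); rewrite ?Y0 // !inE /= fW -gW Y0.
  by rewrite !mul0mx trmx0 mulmx0 !add0r eqxx.
case=> [[X' W'] /= gW /eq_row_mx[/eq_row_mx[-> ->] ->]].
move: gW; rewrite !inE /= => /andP[fW /eqP gW].
by rewrite freeE fW !mul0mx trmx0 mulmx0 !add0r gW !eqxx.
Qed.

(** * Splitting off nondegenerate and radical parts *)

Lemma hyperbolic_unit (F : finFieldType) : hyperbolic F \in unitmx.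
Proof.
have [] // := @mulmx1_unit _ _ (hyperbolic F) (- hyperbolic F).
rewrite mulmxN mulmx_block !(mul0mx, mulmx0, mulmx1, mul1mx, addr0, add0r).
by rewrite opp_block_mx !oppr0 opprK -scalar_mx_block.
Qed.

(** Gram-Schmidt: any complement [C0] becomes orthogonal to [E] after subtracting its projection
    [Y *m E], which exists because [A] is invertible. *)
Lemma orthogonal_split (F : finFieldType) (p d : nat) (A : 'M[F]_p)
    (E : 'M[F]_(p, p + d)) (G : 'M[F]_(p + d)) :
  alternating G -> A \in unitmx -> E *m G *m E^T = A ->
  exists C : 'M[F]_(d, p + d),
    [/\ col_mx E C \in unitmx,
        col_mx E C *m G *m (col_mx E C)^T = block_mx A 0 0 (C *m G *m C^T)
      & \rank G = (p + \rank (C *m G *m C^T))%N].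
Proof.
move=> altG uA gE.
have fE : row_free E.
  by apply/row_freeP; exists (G *m E^T *m invmx A); rewrite !mulmxA gE mulmxV.
have [C0 uP0] := exists_complement fE.
pose Y := C0 *m G *m E^T *m invmx A; pose C := C0 - Y *m E.
have CE : C *m G *m E^T = 0.
  by rewrite !mulmxBl -!mulmxA (mulmxA E) gE !mulmxA mulmxKV // subrr.
have EC : E *m G *m C^T = 0 by rewrite (alternating_swap C E altG) CE trmx0 oppr0.
have uP : col_mx E C \in unitmx.
  have -> : col_mx E C = block_mx 1%:M 0 (- Y) 1%:M *m col_mx E C0.
    by rewrite mul_block_col !mul1mx mul0mx addr0 mulNmx addrC.
  by rewrite unitmx_mul uP0 unitmxE det_lblock !det1 mulr1 unitr1.
have gP : col_mx E C *m G *m (col_mx E C)^T = block_mx A 0 0 (C *m G *m C^T).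
  by rewrite tr_col_mx mul_col_mx mul_col_row gE CE EC.
exists C; split=> //.
transitivity (\rank A + \rank (C *m G *m C^T))%N; last by rewrite (mxrank_unit uA).
rewrite -rank_diag_block_mx -gP mxrankMfree ?row_free_unit ?unitmx_tr //.
by rewrite eqmxMfull ?row_full_unit.
Qed.

Lemma radical_split (F : finFieldType) (d : nat) (v : 'rV[F]_(1 + d))
    (G : 'M[F]_(1 + d)) :
  alternating G -> v != 0 -> v *m G = 0 ->
  exists C : 'M[F]_(d, 1 + d),
    [/\ col_mx v C \in unitmx,
        col_mx v C *m G *m (col_mx v C)^T = block_mx 0 0 0 (C *m G *m C^T)
      & \rank G = \rank (C *m G *m C^T)].
Proof.
move=> altG v0 vG.
have fv : row_free v by rewrite /row_free rank_rV v0.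
have [C uP] := exists_complement fv.
have gP : col_mx v C *m G *m (col_mx v C)^T = block_mx 0 0 0 (C *m G *m C^T).
  rewrite tr_col_mx mul_col_mx mul_col_row (alternating_swap v C altG).
  by rewrite vG !mul0mx trmx0 oppr0.
exists C; split=> //.
transitivity (\rank (0%R : 'M[F]_1) + \rank (C *m G *m C^T))%N; last by rewrite mxrank0.
rewrite -rank_diag_block_mx -gP mxrankMfree ?row_free_unit ?unitmx_tr //.
by rewrite eqmxMfull ?row_full_unit.
Qed.

Lemma card_extensions_split (F : finFieldType) (p d : nat) (A : 'M[F]_p)
    (E : 'M[F]_(p, p + d)) (G : 'M[F]_(p + d)) :
  alternating G -> A \in unitmx -> E *m G *m E^T = A ->
  exists G' : 'M[F]_d, [/\ alternating G', \rank G = (p + \rank G')%N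
    & forall (k : nat) (B : 'M[F]_k), #|extensions E B G| = #|isometries B G'|].
Proof.
move=> altG uA gE; have [C [uP gP rG]] := orthogonal_split altG uA gE.
exists (C *m G *m C^T); split=> // [|k B]; first exact: alternating_congr.
have {1}-> : E = row_mx 1%:M 0 *m col_mx E C.
  by rewrite mul_row_col mul1mx mul0mx addr0.
by rewrite card_extensions_mulr // gP card_extensions_nondegenerate.
Qed.

Lemma card_extensions_radical_split (F : finFieldType) (d : nat)
    (v : 'rV[F]_(1 + d)) (G : 'M[F]_(1 + d)) :
  alternating G -> v != 0 -> v *m G = 0 ->
  exists G' : 'M[F]_d, [/\ alternating G', \rank G = \rank G'
    & forall (k : nat) (B : 'M[F]_k),
        #|extensions v B G| = (#|F| ^ k * #|isometries B G'|)%N].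
Proof.
move=> altG v0 vG; have [C [uP gP rG]] := radical_split altG v0 vG.
exists (C *m G *m C^T); split=> // [|k B]; first exact: alternating_congr.
have {1}-> : v = row_mx 1%:M 0 *m col_mx v C.
  by rewrite mul_row_col mul1mx mul0mx addr0.
by rewrite card_extensions_mulr // gP card_extensions_radical muln1.
Qed.

Lemma exists_dual (F : fieldType) (d : nat) (g : 'rV[F]_d) :
  g != 0 -> exists f : 'rV_d, g *m f^T = 1%:M.
Proof.
move=> g0; have /row_freeP[f gf] : row_free g by rewrite /row_free rank_rV g0.
by exists f^T; rewrite trmxK.
Qed.

Lemma gram_hyperbolic (F : finFieldType) (d : nat) (G : 'M[F]_d) (e f : 'rV_d) :
  alternating G ->
  (col_mx e f *m G *m (col_mx e f)^T == hyperbolic F) = (e *m G *m f^T == 1%:M).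
Proof.
move=> altG; rewrite tr_col_mx mul_col_mx mul_col_row !altG.
rewrite (alternating_swap e f altG).
by apply/eqP/eqP => [/eq_block_mx[_ -> _ _] // | ->]; rewrite trmx1.
Qed.

(** A vector outside the radical is completed to a hyperbolic pair; the complement of the pair is a
    model of v^perp / v. *)
Lemma card_extensions_row_split (F : finFieldType) (d : nat)
    (v : 'rV[F]_(1 + 1 + d)) (G : 'M[F]_(1 + 1 + d)) :
  alternating G -> v *m G != 0 ->
  exists G' : 'M[F]_d, [/\ alternating G', \rank G = (\rank G').+2
    & forall (k : nat) (B : 'M[F]_k),
        #|extensions v B G| = (#|F| ^ k * #|isometries B G'|)%N].
Proof.
move=> altG /exists_dual[f /eqP]; rewrite -gram_hyperbolic // => /eqP gE.
have [C [uP gP rG]] := orthogonal_split altG (hyperbolic_unit F) gE.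
exists (C *m G *m C^T); split=> // [|k B]; first exact: alternating_congr.
have {1}-> : v = row_mx (row_mx (1%:M : 'M_1) (0 : 'M_1)) 0 *m col_mx (col_mx v f) C.
  by rewrite !mul_row_col mul1mx !mul0mx !addr0.
by rewrite card_extensions_mulr // gP card_extensions_hyperbolic.
Qed.

(** A nonzero entry in row i puts the i-th basis vector outside the radical, so it belongs to a
    hyperbolic pair. *)
Lemma card_isometries_source_split (F : finFieldType) (k : nat)
    (B : 'M[F]_(1 + 1 + k)) :
  alternating B -> B != 0 ->
  exists B' : 'M[F]_k, [/\ alternating B', \rank B = (\rank B').+2
    & forall (d : nat) (G : 'M[F]_d),
        #|isometries B G| = #|isometries (block_mx (hyperbolic F) 0 0 B') G|].
Proof.
move=> altB /matrix0Pn[i [j Bij]].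
have : delta_mx 0 i *m B != 0 :> 'rV_(1 + 1 + k).
  by apply: contra Bij => /eqP/rowP/(_ j); rewrite -rowE !mxE => ->.
move=> /exists_dual[f /eqP]; rewrite -gram_hyperbolic // => /eqP gE.
have [C [uP gP rB]] := orthogonal_split altB (hyperbolic_unit F) gE.
exists (C *m B *m C^T); split=> // [|d G]; first exact: alternating_congr.
by rewrite -gP card_isometries_congr.
Qed.

(** * Counting vectors and hyperbolic pairs *)

Lemma card_kernel (F : finFieldType) (d k : nat) (A : 'M[F]_(d, k)) :
  #|[set v : 'rV_d | v *m A == 0]| = (#|F| ^ (d - \rank A))%N.
Proof.
by rewrite -mxrank_ker -card_rowg; apply: eq_card => v; rewrite !inE sub_kermx.
Qed.

(** The solutions form a translate of the hyperplane orthogonal to g. *)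
Lemma card_dual (F : finFieldType) (d : nat) (g : 'rV[F]_d) :
  g != 0 -> #|[set f : 'rV_d | g *m f^T == 1%:M]| = (#|F| ^ d.-1)%N.
Proof.
move=> g0; have [f0 gf0] := exists_dual g0.
have <- : (d - \rank g^T = d.-1)%N by rewrite mxrank_tr rank_rV g0 subn1.
rewrite -card_kernel -[LHS](on_card_preimset (f := +%R f0)); last first.
  by exists (+%R (- f0)) => f _; rewrite ?addKr ?addNKr.
apply: eq_card => f; rewrite !inE linearD /= mulmxDr gf0.
rewrite -subr_eq0 addrC addKr -(inj_eq trmx_inj).
by rewrite trmx_mul trmxK trmx0.
Qed.

(** The first factor counts the choices of e outside the radical, the second the affine hyperplane
    of partners f; a radical e has no partner. *)
Lemma card_hyperbolic_pairs (F : finFieldType) (d : nat) (G : 'M[F]_d) :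
  alternating G ->
  #|[set E : 'M_(1 + 1, d) | E *m G *m E^T == hyperbolic F]|
  = ((#|F| ^ d - #|F| ^ (d - \rank G)) * #|F| ^ d.-1)%N.
Proof.
move=> altG; rewrite -sum1_card.
rewrite (reindex (fun x : 'rV[F]_d * 'rV[F]_d => col_mx x.1 x.2)) /=; last first.
  exists (fun M => (usubmx M, dsubmx M)) => [[e f] _|M _] /=.
    by rewrite col_mxKu col_mxKd.
  exact: vsubmxK.
under eq_bigl do rewrite inE gram_hyperbolic //.
rewrite -(pair_big_dep xpredT (fun e f => e *m G *m f^T == 1%:M) (fun _ _ => 1%N)) /=.
rewrite (bigID (fun e : 'rV_d => e *m G == 0)) /= big1 => [|e /eqP eG]; last first.
  rewrite big_pred0 // => f; rewrite eG mul0mx.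
  by apply/eqP => /matrixP/(_ 0 0)/eqP; rewrite !mxE eq_sym oner_eq0.
rewrite add0n (eq_bigr (fun=> #|F| ^ d.-1)%N) => [|e eG]; last first.
  by rewrite -(card_dual eG) -sum1_card; apply: eq_bigl => f; rewrite inE.
rewrite sum_nat_const; congr (_ * _)%N.
rewrite -card_kernel -[d in (_ ^ d)%N]mul1n -card_mx.
rewrite -(cardC [set v : 'rV_d | v *m G == 0]) addKn.
by apply: eq_card => e; rewrite !inE.
Qed.

(** * The counts satisfy the recurrences *)

Lemma finField_natr_neq0 (F : finFieldType) : (#|F|%:R : rat) != 0.
Proof. by rewrite Num.Theory.pnatr_eq0 -lt0n; apply/card_gt0P; exists 0. Qed.

(** Induction on b, by the first row v. Every v satisfies its own Gram condition because [G] is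
    alternating; the sum is split into v = 0, nonzero radical v and nonradical v. *)
Lemma card_isometries0 (F : finFieldType) (b m n d : nat) (G : 'M[F]_d) :
  alternating G -> d = (2 * m + n)%N -> \rank G = (2 * m)%N ->
  #|isometries (0 : 'M_b) G|%:R
  = eval2 (Qpoly0 #|F| b) (#|F|%:R ^+ (2 * m)) (#|F|%:R ^+ n).
Proof.
have q0 := finField_natr_neq0 F.
elim: b m n d G => [|b IHb] m n d G altG dE rG.
  have -> : isometries (0 : 'M_0) G = setT.
    apply/setP => M; rewrite !inE [_ *m _]flatmx0 eqxx andbT.
    by rewrite /row_free -leqn0 rank_leq_row.
  by rewrite cardsT card_mx eval2_1.
set q := #|F| in q0 IHb *; set t := _ ^+ (2 * m); set u := _ ^+ n.
have -> : #|isometries (0 : 'M[F]_b.+1) G|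
    = #|isometries (block_mx (0 : 'M_1) 0 0 (0 : 'M[F]_b)) G|.
  by rewrite block_mx0.
rewrite card_isometries_block // natr_sum /=.
rewrite (eq_bigl xpredT) => [|v]; last by rewrite altG eqxx.
(* Such a v forces m > 0, and replacing m by m - 1 is t -> q^-2 t. *)
have nonradical (v : 'rV_d) : v *m G != 0 -> #|extensions v (0 : 'M_b) G|%:R
    = q%:R ^+ b * eval2 (Qpoly0 q b) (q%:R ^- 2 * t) u.
  move=> vG; have m0 : (0 < m)%N.
    rewrite lt0n; apply: contra vG => /eqP m0; move: rG; rewrite m0 muln0.
    by move/eqP; rewrite mxrank_eq0 => /eqP ->; rewrite mulmx0.
  have mE : (2 * m = (2 * m.-1).+2)%N by rewrite -{1}(prednK m0) mulnS.
  have {}dE : d = (1 + 1 + (2 * m.-1 + n))%N by rewrite dE mE.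
  have -> : q%:R ^- 2 * t = q%:R ^+ (2 * m.-1).
    by rewrite /t mE -(addn2 (2 * m.-1)) exprD mulrC mulfK // expf_neq0.
  subst d; have [G' [altG' rG' ->]] := card_extensions_row_split altG vG.
  rewrite natrM natrX (IHb m.-1 n) //.
  by move: rG; rewrite rG' mE => -[].
(* Such a v forces n > 0, and replacing n by n - 1 is u -> q^-1 u. *)
have radical (v : 'rV_d) : (v *m G == 0) && (v != 0) ->
    #|extensions v (0 : 'M_b) G|%:R
    = q%:R ^+ b * eval2 (Qpoly0 q b) t (q%:R^-1 * u).
  case/andP=> /eqP vG v0; have n0 : (0 < n)%N.
    rewrite lt0n; apply: contra v0 => /eqP n0.
    have fG : row_free G by rewrite /row_free rG dE n0 addn0.
    by rewrite -(mulmx_free_eq0 v fG) vG.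
  have {}dE : d = (1 + (2 * m + n.-1))%N by rewrite dE addnCA add1n prednK.
  have -> : q%:R^-1 * u = q%:R ^+ n.-1.
    by rewrite /u -{1}(prednK n0) exprS mulKf.
  subst d; have [G' [altG' rG' ->]] := card_extensions_radical_split altG v0 vG.
  by rewrite natrM natrX (IHb m n.-1) // -rG'.
have ext0 : extensions (0 : 'rV_d) (0 : 'M_b) G = set0.
  apply/setP => M; rewrite !inE; apply/negP => /andP[fM _].
  have /eqP : row_mx 1%:M 0 *m col_mx (0 : 'rV_d) M = 0.
    by rewrite mul_row_col mulmx0 mul0mx addr0.
  rewrite mulmx_free_eq0 // => /eqP; rewrite -row_mx0 => /eq_row_mx[/matrixP/(_ 0 0)].
  by move/eqP; rewrite !mxE oner_eq0.
have cK : #|[set v : 'rV_d | v *m G == 0]| = (q ^ n)%N.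
  by rewrite card_kernel rG dE addKn.
rewrite (bigID (fun v : 'rV_d => v *m G == 0)) /=.
rewrite (bigD1 0) ?mul0mx ?eqxx //= ext0 cards0 add0r.
rewrite (eq_bigr _ radical) (eq_bigr _ nonradical) !sumr_const.
rewrite [Qpoly0 _ _]/= eval2_step_b addrC.
set n1 := (X in _ *+ X + _); set n2 := (X in _ + _ *+ X).
(* [n1] counts the nonradical vectors and [n2] the nonzero radical ones; the radical has q^n
   elements. *)
have n1E : (q ^ n + n1 = q ^ d)%N.
  rewrite -cK -[d in RHS]mul1n -card_mx -(cardC [set v : 'rV_d | v *m G == 0]).
  by congr addn; apply: eq_card => v; rewrite !inE.
have n2E : (n2.+1 = q ^ n)%N.
  rewrite -cK (cardsD1 0) inE mul0mx eqxx add1n; congr S.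
  by apply: eq_card => v; rewrite !inE andbC.
have n1R : n1%:R = (t - 1) * u.
  have : (q ^ n + n1)%:R = (q ^ (2 * m + n))%:R :> rat by rewrite n1E dE.
  rewrite natrD !natrX exprD -/t -/u => /(canRL (addKr _)) ->.
  by rewrite mulrBl mul1r addrC.
have n2R : n2%:R = u - 1 by rewrite /u -natrX -n2E -addn1 natrD addrK.
rewrite -[_ *+ n1]mulr_natr -[_ *+ n2]mulr_natr n1R n2R.
move: (eval2 _ _ _) (eval2 _ _ _) (_ ^+ b) => x1 x2 x3; ring.
Qed.

(** Induction on a, by the image of a hyperbolic pair of the source; at a = 0 the source form
    vanishes. *)
Lemma card_isometries (F : finFieldType) (a b m n k d : nat) (B : 'M[F]_k)
    (G : 'M[F]_d) :
  alternating B -> k = (2 * a + b)%N -> \rank B = (2 * a)%N ->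
  alternating G -> d = (2 * m + n)%N -> \rank G = (2 * m)%N ->
  #|isometries B G|%:R
  = eval2 (Qpoly #|F| a b) (#|F|%:R ^+ (2 * m)) (#|F|%:R ^+ n).
Proof.
have q0 := finField_natr_neq0 F.
elim: a m k d B G => [|a IHa] m k d B G altB kE rB altG dE rG.
  rewrite muln0 add0n in kE rB; subst k.
  have -> : B = 0 by apply/eqP; rewrite -mxrank_eq0 rB.
  exact: card_isometries0 dE rG.
have B0 : B != 0 by rewrite -mxrank_eq0 rB mulnS.
rewrite [Qpoly _ _ _]/= eval2_step_a.
set q := #|F| in q0 IHa *.
case: m dE rG => [|m] dE rG.
  (* For m = 0 the target form is zero while [B] is not, so there are no isometries; the factor t -
     1 vanishes as well. *)
  rewrite muln0 expr0 subrr !(mul0r, mulr0).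
  have -> : isometries B G = set0; last by rewrite cards0.
  have -> : G = 0 by apply/eqP; rewrite -mxrank_eq0 rG muln0.
  apply/setP => M; rewrite !inE mulmx0 mul0mx eq_sym (negPf B0).
  exact: andbF.
have {}kE : k = (1 + 1 + (2 * a + b))%N by rewrite kE mulnS.
have dE' : d = (1 + 1 + (2 * m + n))%N by rewrite dE mulnS.
subst k; have [B' [altB' rB' ->]] := card_isometries_source_split altB B0.
rewrite card_isometries_block // natr_sum /=.
rewrite (eq_bigr (fun=> eval2 (Qpoly q a b) (q%:R ^+ (2 * m)) (q%:R ^+ n)))
  => [|E /eqP gE]; last first.
  clear dE; subst d.
  have [G' [altG' rG' ->]] := card_extensions_split altG (hyperbolic_unit F) gE.
  apply: IHa => //; first by move: rB; rewrite rB' mulnS => -[].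
  by move: rG; rewrite rG' mulnS => -[].
rewrite sumr_const.
have -> : #|(fun E : 'M_(1 + 1, d) => E *m G *m E^T == hyperbolic F)|
    = ((q ^ d - q ^ n) * q ^ d.-1)%N.
  rewrite -[n](addKn (\rank G)) [in (_ + n)%N]rG -dE -card_hyperbolic_pairs //.
  by apply: eq_card => E; rewrite inE.
have -> : q%:R ^- 2 * q%:R ^+ (2 * m.+1) = q%:R ^+ (2 * m) :> rat.
  by rewrite mulnS exprD mulKf // expf_neq0.
rewrite -[LHS]mulr_natr mulrC [RHS]mulrA; congr (_ * _).
rewrite natrM natrB ?leq_pexp2l ?dE ?leq_addl //; last first.
  by rewrite lt0n -(Num.Theory.pnatr_eq0 rat).
rewrite !natrX.
(* With d = 2(m+1) + n, the number of pairs becomes (t u - u)(q^-1 t u), the prefactor of the first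
   recurrence. *)
have -> : q%:R ^+ (2 * m.+1 + n).-1 = q%:R^-1 * q%:R ^+ (2 * m.+1 + n) :> rat.
  by rewrite mulnS [in RHS]exprS mulKf.
rewrite exprD; move: (_ ^+ (2 * m.+1)) (_ ^+ n) (_^-1) => x1 x2 x3; ring.
Qed.

(** * The standard spaces and their embeddings *)

Lemma alternating_gram (F : finFieldType) (m n : nat) : alternating (gram F m n).
Proof. by move=> v; apply/matrixP => i j; rewrite !ord1 [LHS]form_alternating mxE. Qed.

Lemma rank_gram (F : finFieldType) (m n : nat) : \rank (gram F m n) = (2 * m)%N.
Proof.
rewrite /gram rank_diag_block_mx mxrank0 addn0 mul2n -addnn; apply: mxrank_unit.
have [] // := @mulmx1_unit _ _ (block_mx 0 1%:M (- 1%:M) (0 : 'M[F]_m))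
  (block_mx 0 (- 1%:M) 1%:M 0).
rewrite mulmx_block !(mul0mx, mulmx0, mulmx1, mul1mx, addr0, add0r) mulNmx.
by rewrite mulmxN mulmx1 opprK -scalar_mx_block.
Qed.

(** Embeddings correspond to their matrices acting on row vectors from the right. *)
Lemma num_embeddingsE (F : finFieldType) (a b m n : nat) :
  num_embeddings F a b m n = #|isometries (gram F a b) (gram F m n)|.
Proof.
pose toF (M : 'M[F]_(a + a + b, m + m + n)) :=
  [ffun x : Vspace F a b => (x *m M : Vspace F m n)].
have toF_inj : injective toF.
  move=> M M' /ffunP E; apply/row_matrixP => i.
  by have := E (delta_mx 0 i); rewrite !ffunE -!rowE.
rewrite -(card_imset _ toF_inj); apply: eq_card => f; rewrite inE.
apply/and3P/imsetP => [[/forallP linf /injectiveP injf /forallP isof]|[M]].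
  have {}linf c x y : f (c *: x + y) = c *: f x + f y.
    by apply/eqP; move/forallP: (linf c) => /(_ x)/forallP.
  (* The function is packed as a linear map so that it has a matrix. *)
  pose fL : {linear 'rV[F]_(a + a + b) -> 'rV[F]_(m + m + n)} :=
    HB.pack (fun x => f x) (GRing.isLinear.Build _ _ _ _ (fun x => f x) linf).
  have fE x : f x = x *m lin1_mx fL by rewrite mul_rV_lin1.
  exists (lin1_mx fL); last by apply/ffunP => x; rewrite ffunE.
  rewrite inE; apply/andP; split.
    by apply: inj_row_free => u uM; apply: injf; rewrite !fE uM mul0mx.
  apply/eqP/matrixP => i j; rewrite -[LHS]bilin_delta -[RHS]bilin_delta.
  have /forallP/(_ (delta_mx 0 j))/eqP := isof (delta_mx 0 i).
  by rewrite /Defs.form !fE trmx_mul !mulmxA => <-.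
rewrite inE => /andP[fM /eqP gM] ->; split.
- apply/forallP => c; apply/forallP => x; apply/forallP => y.
  by rewrite !ffunE mulmxDl scalemxAl.
- by apply/injectiveP => x y; rewrite !ffunE => /(row_free_inj fM).
- apply/forallP => x; apply/forallP => y.
  by rewrite /Defs.form !ffunE trmx_mul -gM !mulmxA.
Qed.

Theorem proposition8p2 (F : finFieldType) (q : nat) (hq : q = #|F|) :
  exists Q : nat -> nat -> {mpoly rat[2]},
    [/\ is_Qfamily q Q,
        forall Q' : nat -> nat -> {mpoly rat[2]},
          is_Qfamily q Q' -> forall a b : nat, Q' a b = Q a b
      & forall a b m n : nat,
          (num_embeddings F a b m n)%:R
            = eval2 (Q a b) (q%:R ^+ (2 * m)) (q%:R ^+ n)].
Proof.
have q_gt0 : (0 < q)%N by rewrite hq; apply/card_gt0P; exists 0.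
have Qfam := Qpoly_is_Qfamily q_gt0.
exists (Qpoly q); split=> // [Q' | a b m n]; first exact: Qfamily_unique.
rewrite hq num_embeddingsE.
have size_gram (i j : nat) : (i + i + j = 2 * i + j)%N by rewrite mul2n addnn.
by apply: card_isometries; rewrite ?rank_gram //; apply: alternating_gram.
Qed.
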